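(* Let $k>1$ and let $\mathcal P$ be a commensurable $k$-pattern on $\mathbb R$ whose enveloping pattern is $\mathcal A_\ell$ (the $\ell$-term arithmetic progressions). If $n$ is a positive integer and $r$ and $s$ are the remainders when $n$ is divided by $k-1$ and by $\ell-1$ respectively, then \[ \frac{(n-s)(n+s-\ell+1)}{2\ell-2}\le S_{\mathcal P}(n)\le\frac{(n-r)(n+r-k+1)}{2k-2}. \]
   Context: A direct similarity of $\mathbb R$ is a map $x\mapsto ax+b$ with $a>0$. A $k$-pattern on $\mathbb R$ is the set $\mathcal P$ of all images under direct similarities of a fixed $k$-element set $P_0\subseteq\mathbb R$; it is commensurable if $P_0$ can be taken to be a subset of $\mathbb Z$ (equivalently, all ratios of distances between points of $P_0$ are rational). For such $P_0$, its enveloping arithmetic progression is the arithmetic progression of minimum cardinality containing $P_0$; if this has $\ell$ terms, the enveloping pattern of $\mathcal P$ is $\mathcal A_\ell$, the set of all $\ell$-term arithmetic progressions $\{a,a+d,\dots,a+(\ell-1)d\}$, $d>0$. For finite $V\subseteq\mathbb R$, $S_{\mathcal P}(V)=|\{P\subseteq V:P\in\mathcal P\}|$ and $S_{\mathcal P}(n)=\max\{S_{\mathcal P}(V):|V|=n\}$. *)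

(* Defs.v *)
From mathcomp Require Import all_boot.
From Stdlib Require Import Reals ZArith ClassicalEpsilon.

Set Implicit Arguments. Unset Strict Implicit. Unset Printing Implicit Defensive.

Definition decP (P : Prop) : bool :=
  if excluded_middle_informative P then true else false.

Definition in_pattern (P0 : list Z) (W : R -> Prop) : Prop :=
  exists a b : R, (0 < a)%R /\
    forall x : R, W x <-> exists2 p : Z, List.In p P0 & x = (a * IZR p + b)%R.

(* S_P(V) for the finite set V = image of an injective f : 'I_n -> R:
   the number of subsets of V that belong to the pattern. *)
Definition count_pattern (n : nat) (P0 : list Z) (f : 'I_n -> R) : nat :=
  #|[set A : {set 'I_n} |
      decP (in_pattern P0 (fun x => exists2 i, i \in A & f i = x))]|.

Definition is_S_max (n : nat) (P0 : list Z) (m : nat) : Prop :=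
  (exists f : 'I_n -> R, injective f /\ count_pattern P0 f = m) /\
  (forall f : 'I_n -> R, injective f -> (count_pattern P0 f <= m)%nat).

Definition ap_cover (l : nat) (P0 : list Z) : Prop :=
  exists a d : R, (0 < d)%R /\
    forall p : Z, List.In p P0 ->
      exists j : nat, (j < l)%nat /\ IZR p = (a + INR j * d)%R.

Definition enveloping_length (l : nat) (P0 : list Z) : Prop :=
  ap_cover l P0 /\ forall m : nat, ap_cover m P0 -> (l <= m)%nat.

(* Main.v *)
Require Import Defs.
From mathcomp Require Import all_boot.
From Stdlib Require Import Reals ZArith.
From Stdlib Require Import Classical Lra Lia ClassicalEpsilon.
From mathcomp Require Import zify ssrZ.
(* ssrbool's decP shadows the one of Defs. *)
Import Defs.
Set Implicit Arguments. Unset Strict Implicit. Unset Printing Implicit Defensive.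

(** Upper bound: cut V, sorted, into k - 1 consecutive blocks of sizes as equal as
possible.  Each copy q_0 < ... < q_(k-1) of P0 in V has a pair q_t, q_(t+1) inside
the t-th block (take t such that q_t does not precede block t but q_(t+1) precedes
block t + 1), and t together with this pair determines the copy, so the number of
copies is at most the sum of the binomials 'C(size of block, 2).

Lower bound: in V = {0, ..., n-1} every l-term progression contains a copy of P0
sharing its first and last terms, so distinct progressions give distinct copies. *)

(** * Counting and sorting tools *)

Lemma decPP (P : Prop) : reflect P (decP P).
Proof. by rewrite /decP; case: excluded_middle_informative => h; constructor. Qed.

(** Choosing for each [x] in [A] one related [y] in [B] gives an injection. A relation suits the
    later uses, where a copy and its code are linked by a property rather than a formula. *)
Lemma leq_card_rel (T U : finType) (A : {set T}) (B : {set U})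
    (r : T -> U -> Prop) :
  (forall x, x \in A -> exists2 y, y \in B & r x y) ->
  (forall x x' y, x \in A -> x' \in A -> r x y -> r x' y -> x = x') ->
  #|A| <= #|B|.
Proof.
move=> tot inj.
pose g x := [pick y in B | decP (r x y)].
have gP x : x \in A -> exists y, [/\ y \in B, r x y & g x = Some y].
  move=> xA; rewrite /g; case: pickP => [y /andP[yB /decPP rxy]|none].
    by exists y.
  by have [y yB rxy] := tot x xA; move: (none y); rewrite yB; case: decPP.
have g_inj : {in A &, injective g}.
  move=> x x' xA x'A gxx'.
  have [y [_ rxy gx]] := gP x xA; have [y' [_ rxy' gx']] := gP x' x'A.
  by move: gxx'; rewrite gx gx' => -[yy']; apply: (inj x x' y) => //; rewrite yy'.
rewrite -(card_in_imset g_inj) -(card_imset B (@Some_inj _)); apply/subset_leq_card.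
apply/subsetP => _ /imsetP[x xA ->].
by have [y [yB _ ->]] := gP x xA; rewrite imset_f.
Qed.

Lemma card_dep_pairs (I U : finType) (P : I -> pred U) :
  #|[set z : I * U | P z.1 z.2]| = \sum_(i : I) #|[set u | P i u]|.
Proof.
rewrite -sum1dep_card -(pair_big_dep predT P (fun _ _ => 1)) /=.
by apply: eq_bigr => i _; rewrite sum1dep_card.
Qed.

Lemma InP (T : eqType) (s : list T) (x : T) : reflect (List.In x s) (x \in s).
Proof.
apply: (iffP idP); elim: s => [|y s IH] //=; rewrite inE.
  by case/orP=> [/eqP ->|/IH]; [left | right].
by case=> [->|/IH ->]; rewrite ?eqxx ?orbT.
Qed.

Lemma NoDup_uniq (T : eqType) (s : list T) : List.NoDup s -> uniq s.
Proof. by elim=> [|x l /InP xl _ /= ->] //; rewrite andbT. Qed.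

Lemma sorted_enumeration (P0 : list Z) : List.NoDup P0 ->
  exists s : seq Z, [/\ size s = length P0,
    forall p, List.In p P0 <-> exists2 t, t < size s & p = nth 0%Z s t &
    forall t, t.+1 < size s -> (nth 0 s t < nth 0 s t.+1)%Z].
Proof.
move=> /NoDup_uniq P0u; exists (sort Z.leb P0).
have leb_total : total Z.leb by move=> x y; lia.
split; first by rewrite size_sort.
  move=> p; split=> [/InP|[t lt_t ->]].
    rewrite -(mem_sort Z.leb) => /(nthP 0%Z)[t lt_t <-].
    by exists t.
  by apply/InP; rewrite -(mem_sort Z.leb) mem_nth.
move=> t lt_t.
have /(sortedP 0%Z) /(_ t lt_t) le_t := sort_sorted leb_total P0.
(* Sorting creates no duplicates, so the weak order between neighbours becomes strict. *)
have : nth 0%Z (sort Z.leb P0) t != nth 0%Z (sort Z.leb P0) t.+1.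
  by rewrite nth_uniq ?sort_uniq ?(ltnW lt_t) //; lia.
by move/eqP; lia.
Qed.

(** * Ordering the points of V by rank *)

Section Rank.
Variables (n : nat) (f : 'I_n -> R).
Hypothesis f_inj : injective f.

(** The position, from 0, of the point [f i] in V sorted increasingly; [f] may list V in any
    order. *)
Definition rank (i : 'I_n) : nat := #|[set j | decP (f j < f i)%R]|.

Lemma rank_lt i : rank i < n.
Proof.
rewrite -[X in _ < X]card_ord -cardsT; apply/proper_card/properP; split=> //.
by exists i; rewrite ?inE //; case: decPP => //; lra.
Qed.

Lemma rank_mono i j : (f i < f j)%R -> rank i < rank j.
Proof.
move=> fij; apply/proper_card/properP; split.
  by apply/subsetP=> h; rewrite !inE => /decPP fhi; apply/decPP; lra.
by exists i; rewrite !inE; [apply/decPP|case: decPP => //; lra].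
Qed.

Lemma rank_inj : injective rank.
Proof.
move=> i j rij; apply: f_inj.
case: (Rtotal_order (f i) (f j)) => [/rank_mono|[//|/rank_mono]]; lia.
Qed.

Definition block (c c' : nat) : {set 'I_n} := [set i | c <= rank i < c'].

(** [rank] embeds the block into the integers from [c] to [c' - 1]. *)
Lemma card_block c c' : #|block c c'| <= c' - c.
Proof.
rewrite cardE -(size_map rank) -[X in _ <= X](size_iota c); apply: uniq_leq_size.
  by rewrite map_inj_uniq ?enum_uniq //; exact: rank_inj.
by move=> x /mapP[i]; rewrite mem_enum inE => ci ->; rewrite mem_iota; lia.
Qed.

End Rank.

(** * Upper bound by two-point subsets of blocks *)

(** A discrete intermediate value argument, used to locate a block holding two consecutive points of
    a copy. *)
Lemma exists_crossing (P : nat -> Prop) K :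
  P 0 -> ~ P K -> exists2 t, t < K & P t /\ ~ P t.+1.
Proof.
move=> P0; elim: K => [//|K IH] nPK.
have [PK|/IH[t lt_tK Pt]] := classic (P K); first by exists K.
by exists t => //; lia.
Qed.

(** These pairs serve as codes for the copies; the fibre over [t] consists of the two-point subsets
    of block [t]. *)
Lemma card_two_point_blocks n (f : 'I_n -> R) K (c : nat -> nat) :
  injective f ->
  #|[set z : 'I_K * {set 'I_n} |
      (z.2 \subset block f (c z.1) (c z.1.+1)) && (#|z.2| == 2)]|
  <= \sum_(t < K) 'C(c t.+1 - c t, 2).
Proof.
move=> f_inj.
rewrite (card_dep_pairs
  (fun (t : 'I_K) (E : {set 'I_n}) => (E \subset block f (c t) (c t.+1)) && (#|E| == 2))).
apply: leq_sum => t _.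
by rewrite cards_draws; apply/leq_bin2l/card_block.
Qed.

Lemma eq_set2_lt n (f : 'I_n -> R) (i j i' j' : 'I_n) :
  (f i < f j)%R -> (f i' < f j')%R -> [set i; j] = [set i'; j'] ->
  i = i' /\ j = j'.
Proof.
move=> ij ij' E.
have: i \in [set i'; j'] by rewrite -E set21.
have: j \in [set i'; j'] by rewrite -E set22.
by rewrite !inE => /orP[]/eqP ? /orP[]/eqP ?; subst; split=> //; lra.
Qed.

Lemma count_pattern_leq_blocks n K (P0 : list Z) (f : 'I_n -> R) (c : nat -> nat) :
  List.NoDup P0 -> length P0 = K.+1 -> injective f -> c 0 = 0 -> c K = n ->
  count_pattern P0 f <= \sum_(t < K) 'C(c t.+1 - c t, 2).
Proof.
move=> P0u P0K f_inj c0 cK.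
have [s [ss sP s_lt]] := sorted_enumeration P0u.
rewrite P0K in ss; rewrite ss in sP s_lt.
pose image (a b : R) (A : {set 'I_n}) := forall x : R,
  (exists2 i, i \in A & f i = x) <-> exists2 p, List.In p P0 & x = (a * IZR p + b)%R.
(* [z] codes [A] when [z.2] consists of the points numbered [z.1] and [z.1.+1] of the copy [A]. *)
pose meets (A : {set 'I_n}) (z : 'I_K * {set 'I_n}) := exists a b i j,
  [/\ (0 < a)%R, image a b A, z.2 = [set i; j], f i = (a * IZR (nth 0%Z s z.1) + b)%R
    & f j = (a * IZR (nth 0%Z s z.1.+1) + b)%R].
have step a b t : (0 < a)%R -> t < K ->
    (a * IZR (nth 0%Z s t) + b < a * IZR (nth 0%Z s t.+1) + b)%R.
  by move=> a0 tK; have /IZR_lt := s_lt t tK; nra.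
apply: leq_trans (card_two_point_blocks K c f_inj).
apply: (leq_card_rel (r := meets)) => [A|A A' z _ _].
  rewrite inE => /decPP[a [b [a0 Aab]]].
  have ptE t : t <= K -> exists i, f i = (a * IZR (nth 0%Z s t) + b)%R.
    move=> tK; have [_] := Aab (a * IZR (nth 0%Z s t) + b)%R; case.
      by exists (nth 0%Z s t) => //; apply/sP; exists t.
    by move=> i _ <-; exists i.
  (* The point numbered [t] does not precede block [t]. This holds at 0 as [c 0 = 0], and fails at
     [K] as all ranks are below [n = c K]. *)
  pose before t := exists2 i, f i = (a * IZR (nth 0%Z s t) + b)%R & c t <= rank f i.
  have [||t tK [[i fi ci] ncj]] := @exists_crossing before K.
  - by have [i fi] := ptE 0 isT; exists i => //; rewrite c0.
  - by case=> i _; rewrite cK leqNgt rank_lt.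
  have [j fj] := ptE t.+1 tK.
  have cj : rank f j < c t.+1.
    by rewrite ltnNge; apply/negP => cj; apply: ncj; exists j.
  have ij : (f i < f j)%R by rewrite fi fj; apply: step.
  have rij := rank_mono ij.
  exists (Ordinal tK, [set i; j]); last by exists a, b, i, j.
  rewrite inE /= cards2; apply/andP; split.
    by apply/subsetP => h; rewrite !inE => /orP[]/eqP ->; lia.
  by have -> : i != j by apply/eqP => E; rewrite E in ij; lra.
case: z => t E [a [b [i [j [a0 Aab /= -> fi fj]]]]] [a' [b' [i' [j' [a0' Aab' /= E' fi' fj']]]]].
have tt := step a b t a0 (ltn_ord t).
have tt' := step a' b' t a0' (ltn_ord t).
have [||ii jj] := @eq_set2_lt n f i j i' j' _ _ E'; try by rewrite ?fi ?fj ?fi' ?fj'.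
subst i' j'.
(* An affine map is determined by its values at two distinct points: first the slopes agree, then
   the constants. *)
have aa : a = a'.
  have /IZR_lt st := s_lt t (ltn_ord t).
  apply: (Rmult_eq_reg_r (IZR (nth 0%Z s t.+1) - IZR (nth 0%Z s t))); lra.
subst a'; have bb : b = b' by lra.
subst b'; apply/setP => h.
have mem (B : {set 'I_n}) : h \in B <-> exists2 i, i \in B & f i = f h.
  by split=> [hB|[g gB /f_inj <-]]; [exists h|].
have AA' : h \in A <-> h \in A'.
  by have := mem A; have := mem A'; have := Aab (f h); have := Aab' (f h); tauto.
by apply/idP/idP => /AA'.
Qed.

(** Sum [2 * 'C(m, 2) + m = m * m] over [r] blocks of size [q + 1] and [K - r] of size [q], then
    cancel [r]. This form avoids division and subtraction in [nat]. *)
Lemma sum_balanced_bin2 K q r : r <= K ->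
  2 * (\sum_(t < K) 'C(q + (t < r), 2)) + K * q = K * (q * q) + 2 * r * q.
Proof.
have bin2' m : 2 * 'C(m, 2) + m = m * m.
  by elim: m => [|m IH] //; rewrite binS bin1; nia.
move=> rK; rewrite -[in RHS](minn_idPl rK); elim: K {rK} => [|K IH].
  by rewrite big_ord0; lia.
rewrite big_ord_recr /= mulnDr.
move: IH (bin2' (q + (K < r))); set S := \sum_(t < K) _; set B := 'C(_, 2).
have [Kr|rK] := ltnP K r.
  have -> : minn r K.+1 = K.+1 by lia.
  by nia.
have -> : minn r K.+1 = r by lia.
by nia.
Qed.

Lemma count_pattern_upper n K (P0 : list Z) (f : 'I_n -> R) :
  List.NoDup P0 -> length P0 = K.+1 -> 0 < K -> injective f ->
  2 * count_pattern P0 f + K * (n %/ K)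
    <= K * (n %/ K * (n %/ K)) + 2 * (n %% K) * (n %/ K).
Proof.
move=> P0u P0K K0 f_inj; rewrite -sum_balanced_bin2; last exact/ltnW/ltn_pmod.
rewrite leq_add2r leq_mul2l /=.
(* The first [n %% K] blocks get one extra point each. *)
pose c t := t * (n %/ K) + minn t (n %% K).
apply: leq_trans (count_pattern_leq_blocks (c := c) P0u P0K f_inj _ _) _.
- by rewrite /c min0n.
- by rewrite /c (minn_idPr (ltnW (ltn_pmod n K0))) mulnC -divn_eq.
apply: leq_sum => t _; apply: leq_bin2l.
by rewrite /c mulSn; case: (ltnP t (n %% K)) => /=; set p := (t * _); set h := n %/ K; lia.
Qed.

(** * Lower bound from an initial segment of the integers *)

(* If 0 or l - 1 were missed, l - 1 terms would already cover P0. *)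
Lemma enveloping_offsets l (P0 : list Z) :
  0 < length P0 -> enveloping_length l P0 ->
  exists (a d : R) (j : Z -> nat), [/\ (0 < d)%R,
    forall p, List.In p P0 -> j p < l /\ IZR p = (a + INR (j p) * d)%R,
    exists2 p, List.In p P0 & j p = 0
  & exists2 p, List.In p P0 & j p = l.-1].
Proof.
move=> P0_gt0 [[a [d [d0 cov]]] lmin].
have /choice[j jP] : forall p, exists i, List.In p P0 -> i < l /\ IZR p = (a + INR i * d)%R.
  move=> p; have [/cov[i ?]|] := classic (List.In p P0); first by exists i.
  (* A default offset for [p] outside [P0]. *)
  by exists 0.
have l0 : 0 < l.
  case: P0 P0_gt0 jP {cov lmin} => // p P0 _ /(_ p) jP.
  by case: jP => [|]; [left | lia].
have not_shorter : ~ ap_cover l.-1 P0 by move/lmin; lia.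
exists a, d, j; split=> //; apply: NNPP => no; apply: not_shorter.
  exists (a + d)%R, d; split=> // p pP0; have [jl pE] := jP p pP0.
  have jp0 : 0 < j p by rewrite lt0n; apply/eqP => jp0; apply: no; exists p.
  exists (j p).-1; split; first lia.
  rewrite pE; case: (j p) jp0 => // i _; rewrite S_INR /=; lra.
exists a, d; split=> // p pP0; have [jl pE] := jP p pP0.
exists (j p); split=> //.
have : j p <> l.-1 by move=> jp; apply: no; exists p.
lia.
Qed.

Definition initial_segment n (i : 'I_n) : R := INR i.

Lemma initial_segment_inj n : injective (@initial_segment n).
Proof. by move=> i j /INR_eq /val_inj. Qed.

(* The index e stands for the difference e + 1, and c for the first term. *)
Lemma count_initial_segment n l (P0 : list Z) :
  1 < length P0 -> List.NoDup P0 -> enveloping_length l P0 ->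
  1 < l /\
  \sum_(e < n %/ l.-1) (n - l.-1 * e.+1) <= count_pattern P0 (@initial_segment n).
Proof.
move=> P0_gt1 P0u env.
have [a [d [j [d0 jP [p0 p0P jp0] [p1 p1P jp1]]]]] := enveloping_offsets (ltnW P0_gt1) env.
have l1 : 1 < l.
  (* With [l <= 1] every offset is 0, yet [P0] has two distinct points. *)
  have [s [ss sP s_lt]] := sorted_enumeration P0u.
  rewrite -ss in P0_gt1; have lt01 := s_lt 0 P0_gt1.
  have [|j0 E0] := jP (nth 0%Z s 0); first by apply/sP; exists 0 => //; lia.
  have [|j1 E1] := jP (nth 0%Z s 1); first by apply/sP; exists 1.
  rewrite ltnNge; apply/negP => l_le1.
  have : IZR (nth 0%Z s 0) = IZR (nth 0%Z s 1).
    by rewrite E0 E1; have -> : j (nth 0%Z s 0) = j (nth 0%Z s 1) by lia.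
  by move/eq_IZR; lia.
split=> //.
(* The last term stays below [n]. If [l.-1] divides [n], the largest [e] contributes 0. *)
pose Q (e : 'I_(n %/ l.-1)) (c : 'I_n) := c + l.-1 * e.+1 < n.
have -> : \sum_(e < n %/ l.-1) (n - l.-1 * e.+1) = #|[set z | Q z.1 z.2]|.
  rewrite card_dep_pairs; apply: eq_bigr => e _.
  have le_n : n - l.-1 * e.+1 <= n by lia.
  have widen_inj : injective (widen_ord le_n) by move=> x y [] /val_inj.
  rewrite -[LHS]card_ord -(card_imset _ widen_inj).
  apply: eq_card => c; rewrite inE; apply/imsetP/idP => [[i _ ->]|cn].
    by rewrite /Q /=; have := ltn_ord i; lia.
  have ci : c < n - l.-1 * e.+1 by move: cn; rewrite /Q; lia.
  by exists (Ordinal ci) => //; apply: val_inj.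
pose copy (z : 'I_(n %/ l.-1) * 'I_n) (A : {set 'I_n}) := forall i : 'I_n,
  i \in A <-> exists2 p, List.In p P0 & i = z.2 + j p * z.1.+1 :> nat.
apply: (leq_card_rel (r := copy)) => [[e c]|[e c] [e' c'] A].
  rewrite inE /Q /= => cn.
  pose A := [set i : 'I_n | decP (exists2 p, List.In p P0 & i = c + j p * e.+1 :> nat)].
  have AP : copy (e, c) A by move=> i; rewrite inE /=; split=> /decPP.
  exists A => //; rewrite inE; apply/decPP.
  have e0 : (0 < INR e.+1)%R by apply: lt_0_INR; lia.
  (* The similarity that takes the first term [a] to [c] and the difference [d] to [e + 1]. *)
  exists (INR e.+1 / d)%R, (INR c - INR e.+1 / d * a)%R; split.
    by apply: Rdiv_lt_0_compat.
  have ptE p : List.In p P0 ->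
      (INR (c + j p * e.+1) = INR e.+1 / d * IZR p + (INR c - INR e.+1 / d * a))%R.
    move=> pP; have [_ ->] := jP p pP.
    by rewrite plus_INR mult_INR; field; lra.
  move=> x; split=> [[i /AP[p pP iE] <-]|[p pP ->]].
    by exists p => //; rewrite -ptE // -iE.
  have [jl _] := jP p pP.
  have in_n : c + j p * e.+1 < n by nia.
  exists (Ordinal in_n); last by rewrite /initial_segment -ptE.
  by apply/AP; exists p.
rewrite !inE /Q /= => cn cn' Ac Ac'.
(* If two progressions give the same copy, the end terms of the first, which lie in the copy, lie
   between those of the second. By symmetry the end terms agree. *)
have bounds (e1 e2 : 'I_(n %/ l.-1)) (c1 c2 : 'I_n) : c1 + l.-1 * e1.+1 < n ->
    copy (e1, c1) A -> copy (e2, c2) A ->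
    c2 <= c1 /\ c1 + l.-1 * e1.+1 <= c2 + l.-1 * e2.+1.
  move=> lt_n A1 A2; split.
    have /A2[p _ /= ->] : c1 \in A by apply/A1; exists p0; rewrite ?jp0 //=; lia.
    by lia.
  have /A2[p pP /= ->] : Ordinal lt_n \in A by apply/A1; exists p1; rewrite ?jp1 //=; lia.
  by have [jl _] := jP p pP; nia.
have [cc ee] := bounds _ _ _ _ cn Ac Ac'; have [cc' ee'] := bounds _ _ _ _ cn' Ac' Ac.
have cE : c = c' by apply: val_inj; rewrite /=; lia.
by congr pair => //; subst c'; apply: val_inj => /=; nia.
Qed.

(** Under the hypothesis no truncated subtraction loses anything, so this is the usual arithmetic
    sum. *)
Lemma sum_progression n L q : L * q <= n ->
  2 * (\sum_(e < q) (n - L * e.+1)) + L * q * q.+1 = 2 * n * q.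
Proof.
elim: q => [|q IH] Lq; first by rewrite big_ord0; lia.
rewrite big_ord_recr /= mulnDr.
by have := IH (leq_trans (leq_mul (leqnn L) (leqnSn q)) Lq); set S := \sum_(e < q) _; nia.
Qed.

(** * Existence of the maximum and the two bounds *)

Lemma is_S_max_exists n (P0 : list Z) : exists m, is_S_max n P0 m.
Proof.
pose P m := decP (exists f : 'I_n -> R, injective f /\ count_pattern P0 f = m).
have exP : exists m, P m.
  exists (count_pattern P0 (@initial_segment n)); apply/decPP.
  by exists (@initial_segment n); split=> //; apply: initial_segment_inj.
have ubP m : P m -> m <= #|{set 'I_n}|.
  by move=> /decPP[f [_ <-]]; apply: max_card.
case: (ex_maxnP exP ubP) => m /decPP Pm max_m; exists m; split=> // f f_inj.
by apply: max_m; apply/decPP; exists f.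
Qed.

Theorem mainTheorem12 (k l n : nat) (P0 : list Z) :
  (1 < k)%nat ->
  List.NoDup P0 -> List.length P0 = k ->
  enveloping_length l P0 ->
  (0 < n)%nat ->
  let r := (n %% (k - 1))%nat in
  let s := (n %% (l - 1))%nat in
  exists m : nat, is_S_max n P0 m /\
    ((INR n - INR s) * (INR n + INR s - INR l + 1) / (2 * INR l - 2) <= INR m)%R /\
    (INR m <= (INR n - INR r) * (INR n + INR r - INR k + 1) / (2 * INR k - 2))%R.
Proof.
move=> k1 P0u P0k env _ r s.
have [m m_max] := is_S_max_exists n P0; exists m; split=> //.
have [[f [f_inj fm]] max_m] := m_max; split.
  have [|l1 lower] := count_initial_segment n _ P0u env; first by rewrite P0k.
  have {}lower := leq_trans lower (max_m _ (@initial_segment_inj n)).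
  rewrite /s subn1; case: l l1 lower {env s} => [//|[//|L]] _; rewrite [_.+2.-1]/= => lower.
  have := divn_eq n L.+1; set q := n %/ L.+1 in lower *; set s := n %% _ => nE.
  have /sum_progression sumE : L.+1 * q <= n by lia.
  (* Here [l - 1 = L.+1] and [n - s = L.+1 * q], so [2nq - (l-1)q(q+1) = q(n+s-l+1)], twice the
     claimed bound. *)
  have /leP/le_INR : 2 * n * q <= 2 * m + L.+1 * q * q.+1.
    by rewrite -sumE leq_add2r leq_mul2l.
  rewrite nE !(plus_INR, mult_INR, S_INR) /=; have := pos_INR L.
  set x := INR L; set y := INR q; set z := INR s; set w := INR m => x0 H.
  apply: (Rmult_le_reg_r (2 * (x + 1 + 1) - 2)); first lra.
  rewrite /Rdiv Rmult_assoc Rinv_l ?Rmult_1_r; last lra.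
  by nra.
rewrite {}/r subn1; case: k k1 P0k => [//|[//|K]] _ P0k.
rewrite [_.+2.-1]/=; set r := n %% K.+1.
have := count_pattern_upper P0u P0k isT f_inj; rewrite fm -/r.
have := divn_eq n K.+1; rewrite -/r; set q := n %/ K.+1 => nE.
move/leP/le_INR; rewrite nE !(plus_INR, mult_INR, S_INR) /=; have := pos_INR K.
set x := INR K; set y := INR q; set z := INR r; set w := INR m => x0 H.
(* As [n - r = (k-1)q], [H] says that [2m] is at most [q(n+r-k+1)], twice the claimed bound. *)
apply: (Rmult_le_reg_r (2 * (x + 1 + 1) - 2)); first lra.
rewrite /Rdiv Rmult_assoc Rinv_l ?Rmult_1_r; last lra.
by nra.
Qed.
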